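(* Let $r\ge 2$ be an integer, and let $n_2,n_3,\dots,n_r,m,w$ be nonnegative integers with $n_2$ even and $n_2\ge 2$. Suppose that for each $k$ with $2\le k\le r$ there are $n_k$ $k$-tuples (families consisting of one husband and his $k-1$ wife/wives), and that in addition there are $m$ single men and $w$ single women. The number of ways to seat all these persons around a circular table such that (1) all members of each family sit together, (2) no man sits adjacent to a woman except his own wife/wives, and (3) every husband having more than one wife is surrounded by his wives, is $$\prod_{k=3}^{r}\bigl((k-2)\cdot (k-1)!\bigr)^{n_k}\cdot \frac{n_2!}{\left(\frac{n_2}{2}\right)!}\cdot \frac{\left(\frac{n_2}{2}+m-1\right)!}{\left(\frac{n_2}{2}-1\right)!}\cdot \left(\sum_{k=3}^{r} n_k+\frac{n_2}{2}+w-1\right)!.$$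
   Context: All persons are distinguishable. Every person belongs to exactly one family ($k$-tuple for some $2\le k\le r$) or is a single man or a single woman. The circular table has exactly as many seats as there are persons, and each person occupies one seat. Two seatings are regarded as the same if and only if one is obtained from the other by a rotation of the table; opposite orientations (mirror images) are counted as different. ''Adjacent'' means occupying cyclically neighbouring seats. Condition (1), ''all members of a family sit together'', means that the members of each family occupy a set of cyclically consecutive seats. Condition (2) means that whenever a man and a woman are adjacent, the woman is a wife of that man (so in particular single men are never adjacent to a woman, and single women are never adjacent to a man). Condition (3), ''surrounded by his wives'', means that both neighbours of such a husband are his own wives. Empty products equal $1$ and empty sums equal $0$. *)

(* Defs.v *)
From HB Require Import structures.
From mathcomp Require Import all_boot.

Set Implicit Arguments.
Unset Strict Implicit.
Unset Printing Implicit Defensive.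

(* A seating of T lists the persons in seat order, seat 0 being followed by
   seat 1, ..., and the last seat by seat 0.  A duplicate-free #|T|.-tuple T
   contains every element of T exactly once. *)
Definition is_seating (T : finType) (t : #|T|.-tuple T) : bool := uniq t.

Definition same_up_to_rotation (T : finType) : rel (#|T|.-tuple T) :=
  fun s t => [exists d : 'I_#|T|, rot d s == t :> seq T].

Definition adjacent (T : finType) (t : #|T|.-tuple T) : rel T :=
  fun x y => (next t x == y) || (prev t x == y).

(* A occupies the #|A| cyclically consecutive seats d, d + 1, ... *)
Definition sits_together (T : finType) (t : #|T|.-tuple T) (A : {set T}) : bool :=
  [exists d : 'I_#|T|, [set x in take #|A| (rot d t)] == A].

(* The families with tag i are the k-tuples for k = i + 2, so that k ranges
   over 2, ..., r; the values of n outside this range are not used. *)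
Definition family (r : nat) (n : nat -> nat) : finType :=
  {i : 'I_r.-1 & 'I_(n i.+2)}.

Definition family_size (r : nat) (n : nat -> nat) (f : family r n) : nat :=
  (tag f).+2.

Definition nb_wives (r : nat) (n : nat -> nat) (f : family r n) : nat :=
  (family_size f).-1.

Inductive person (r : nat) (n : nat -> nat) (m w : nat) : Type :=
  | Husband of family r n
  | Wife (f : family r n) of 'I_(nb_wives f)
  | SingleMan of 'I_m
  | SingleWoman of 'I_w.

Arguments Husband {r n m w} f.
Arguments Wife {r n m w} f j.
Arguments SingleMan {r n m w} i.
Arguments SingleWoman {r n m w} i.

Definition person_encode (r : nat) (n : nat -> nat) (m w : nat)
    (p : person r n m w) :
    family r n + {f : family r n & 'I_(nb_wives f)} + 'I_m + 'I_w :=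
  match p with
  | Husband f => inl (inl (inl f))
  | Wife f j => inl (inl (inr (existT _ f j)))
  | SingleMan i => inl (inr i)
  | SingleWoman i => inr i
  end.

Definition person_decode (r : nat) (n : nat -> nat) (m w : nat)
    (c : family r n + {f : family r n & 'I_(nb_wives f)} + 'I_m + 'I_w) :
    person r n m w :=
  match c with
  | inl (inl (inl f)) => Husband f
  | inl (inl (inr (existT f j))) => Wife f j
  | inl (inr i) => SingleMan i
  | inr i => SingleWoman i
  end.

Lemma person_encodeK (r : nat) (n : nat -> nat) (m w : nat) :
  cancel (@person_encode r n m w) (@person_decode r n m w).
Proof. by case. Qed.

HB.instance Definition _ (r : nat) (n : nat -> nat) (m w : nat) :=
  Finite.copy (person r n m w) (can_type (@person_encodeK r n m w)).

Definition is_man (r : nat) (n : nat -> nat) (m w : nat)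
    (p : person r n m w) : bool :=
  match p with
  | Husband _ | SingleMan _ => true
  | Wife _ _ | SingleWoman _ => false
  end.

Definition family_of (r : nat) (n : nat -> nat) (m w : nat)
    (p : person r n m w) : option (family r n) :=
  match p with
  | Husband f | Wife f _ => Some f
  | SingleMan _ | SingleWoman _ => None
  end.

Definition members (r : nat) (n : nat -> nat) (m w : nat) (f : family r n) :
    {set person r n m w} :=
  [set p | family_of p == Some f].

Definition is_wife_of (r : nat) (n : nat -> nat) (m w : nat)
    (x y : person r n m w) : bool :=
  match x, y with
  | Wife f _, Husband g => f == g
  | _, _ => false
  end.

Definition families_together (r : nat) (n : nat -> nat) (m w : nat)
    (t : #|{: person r n m w}|.-tuple (person r n m w)) : bool :=
  [forall f : family r n, sits_together t (members m w f)].

Definition only_own_wives_adjacent (r : nat) (n : nat -> nat) (m w : nat)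
    (t : #|{: person r n m w}|.-tuple (person r n m w)) : bool :=
  [forall x, forall y,
    [&& is_man x, ~~ is_man y & adjacent t x y] ==> is_wife_of y x].

Definition husbands_surrounded (r : nat) (n : nat -> nat) (m w : nat)
    (t : #|{: person r n m w}|.-tuple (person r n m w)) : bool :=
  [forall f : family r n, (1 < nb_wives f) ==>
    is_wife_of (prev t (Husband f)) (Husband f) &&
    is_wife_of (next t (Husband f)) (Husband f)].

Definition admissible_seatings (r : nat) (n : nat -> nat) (m w : nat) :
    {set #|{: person r n m w}|.-tuple (person r n m w)} :=
  [set t | [&& is_seating t, families_together t,
               only_own_wives_adjacent t & husbands_surrounded t]].

Definition nb_circular_seatings (r : nat) (n : nat -> nat) (m w : nat) : nat :=
  #|equivalence_partition (@same_up_to_rotation (person r n m w))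
      (admissible_seatings r n m w)|.

(* Main.v *)
(* Cut the circle at one couple and contract every family to a block.  A
   seating becomes a cyclic word of blocks in which the two ends that meet at
   a junction have the same sex: single men are blocks with two male ends,
   single women and families with at least two wives are blocks with two
   female ends, and a couple is a block with ends of opposite sexes.

   The words made of couples only are determined by the orientation of the
   first couple and the order of the others: 2 (n_2 - 1)! of them.  The other
   blocks are then inserted one at a time.  A block with two ends of sex a
   fits exactly at the junctions of sex a, and going round the circle there
   are as many blocks starting with sex a as blocks ending with it, so that
   there are n_2 / 2 such junctions plus one for each block of that kind
   already present.  Hence the product of the two rising factorials of n_2 / 2
   with m and with n_3 + ... + n_r + w factors. *)
Require Import Defs.
From mathcomp Require Import all_boot.

Set Implicit Arguments.
Unset Strict Implicit.
Unset Printing Implicit Defensive.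

(** * Enumeration up to fibers *)

(** Words of blocks live in infinite types, so a cardinal is witnessed by a duplicate-free
    enumeration. *)
Definition ncount (T : eqType) (P : T -> Prop) (N : nat) : Prop :=
  exists l : seq T, [/\ uniq l, forall x, x \in l <-> P x & size l = N].

Lemma ncount_seq (T : eqType) (l : seq T) (P : T -> Prop) :
  uniq l -> (forall x, x \in l <-> P x) -> ncount P (size l).
Proof. by move=> ul lP; exists l. Qed.

Lemma ncount_inj (T : eqType) (P : T -> Prop) M N :
  ncount P M -> ncount P N -> M = N.
Proof.
move=> [l [ul lP <-]] [l' [ul' l'P <-]].
by apply: perm_size; apply: uniq_perm => // x; apply/idP/idP=> [/lP/l'P|/l'P/lP].
Qed.

Lemma ncount_ext (T : eqType) (P Q : T -> Prop) N :
  (forall x, P x <-> Q x) -> ncount P N -> ncount Q N.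
Proof.
by move=> PQ [l [ul lP sl]]; exists l; split=> // x; split=> [/lP/PQ|/PQ/lP].
Qed.

Lemma ncount_image (T U : eqType) (f : T -> U) (P : T -> Prop) (Q : U -> Prop) N :
    ncount P N -> (forall x y, P x -> P y -> f x = f y -> x = y) ->
    (forall y, Q y <-> exists2 x, P x & y = f x) ->
  ncount Q N.
Proof.
move=> [l [ul lP sl]] f_inj QP; exists (map f l); split; last by rewrite size_map.
  by rewrite map_inj_in_uniq // => x y /lP Px /lP Py; apply: f_inj.
move=> y; split=> [/mapP[x /lP Px ->] | /QP[x Px ->]]; last exact/map_f/lP.
by apply/QP; exists x.
Qed.

(** The enumerations of the fibers, concatenated along an enumeration of the base, list [Q] without
    repetition. The map [f] will be the deletion of one block from a word. *)
Lemma ncount_fiber (T U : eqType) (f : T -> U) (P : U -> Prop) (Q : T -> Prop) N k :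
    ncount P N -> (forall x, Q x -> P (f x)) ->
    (forall y, P y -> ncount (fun x => Q x /\ f x = y) k) ->
  ncount Q (N * k).
Proof.
move=> [l [ul lP <-]] QP fibP.
suff /(_ l ul) : forall l', uniq l' -> {subset l' <= l} ->
    ncount (fun x => Q x /\ f x \in l') (size l' * k).
  move/(_ (fun _ => id)); apply: ncount_ext => x; split=> [[]//|Qx].
  by split=> //; apply/lP/QP.
elim=> [|y l' IH] /=; first by exists [::]; split=> // x; split=> // -[].
case/andP=> yl' /IH{}IH sub.
have [|l1 [ul1 l1P sl1]] := IH; first by move=> z zl'; apply/sub/mem_behead.
have [|l2 [ul2 l2P sl2]] := fibP y; first by apply/lP/sub/mem_head.
exists (l2 ++ l1); split; last by rewrite size_cat sl1 sl2 mulSn.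
  rewrite cat_uniq ul1 ul2 andbT /=; apply/hasPn=> x /l1P[_ fx].
  by apply: contraNN yl' => /l2P[_ <-].
move=> x; rewrite mem_cat inE; split.
  by case/orP=> [/l2P[Qx ->] | /l1P[Qx ->]]; rewrite ?eqxx ?orbT.
by case=> Qx /orP[/eqP fx | fx]; apply/orP; [left; apply/l2P | right; apply/l1P].
Qed.

Definition insert_at (T : Type) (j : nat) (x : T) (s : seq T) : seq T :=
  take j s ++ x :: drop j s.

(** The predicate [a] recognises the inserted letter and no other, so [find a] recovers the position
    from the result. *)
Lemma insert_at_inj (T : eqType) (a : pred T) j k x y (s t : seq T) :
    ~~ has a s -> ~~ has a t -> a x -> a y -> j <= size s -> k <= size t ->
    insert_at j x s = insert_at k y t ->
  [/\ j = k, x = y & s = t].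
Proof.
move=> as_ at_ ax ay js kt e.
have fnd i z u : ~~ has a u -> a z -> i <= size u -> find a (insert_at i z u) = i.
  move=> au az iu; rewrite /insert_at find_cat ifN ?size_takel //= ?az ?addn0 //.
  by rewrite -(cat_take_drop i u) has_cat negb_or in au; case/andP: au.
have ejk : j = k by rewrite -(fnd j x s) // e fnd.
move: kt e; rewrite /insert_at -{}ejk => jt /eqP.
rewrite eqseq_cat ?size_takel // => /andP[/eqP et /eqP[exy ed]].
by split=> //; rewrite -(cat_take_drop j s) et ed cat_take_drop.
Qed.

Lemma perm_insert (T : eqType) (p : seq T) x q : perm_eq (p ++ x :: q) (x :: p ++ q).
Proof. by rewrite (perm_catCA p [:: x]). Qed.

(** * Cyclic words of blocks *)

Section Arrangements.

(* An item i stands for the entity ent i in one of its versions; lft i and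
   rgt i are the sexes of its two ends, and kind e is the common sex of the
   ends of the versions of e, or None for a couple.  Sexes are booleans, true
   for men. *)
Variables (E I : eqType) (ent : I -> E) (lft rgt : I -> bool) (ok : pred I).
Variable (kind : E -> option bool).

Hypothesis ok_kind : forall i, ok i ->
  if kind (ent i) is Some a then lft i = a /\ rgt i = a else rgt i = ~~ lft i.

Definition glue : rel I := fun i j => rgt i == lft j.

(** Cutting the cyclic word at the entity [c] fixes its rotation; [cycle glue] also checks the
    junction across the cut. *)
Definition arrangement (c : E) (L : seq E) (s : seq I) : Prop :=
  [/\ ohead (map ent s) = Some c, perm_eq (map ent s) (c :: L), all ok s
    & cycle glue s].

Lemma path_glue_map i s :
  path glue i s -> map rgt (belast i s) = map lft s.
Proof. by elim: s i => //= j s IH i /andP[/eqP-> /IH->]. Qed.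

(** Around a cycle the sexes of the right ends are those of the left ends, shifted by one block. *)
Lemma cycle_glue_count a s :
  cycle glue s -> count (fun i => rgt i == a) s = count (fun i => lft i == a) s.
Proof.
case: s => // i s /= /path_glue_map; rewrite belast_rcons => e.
have /= := congr1 (count_mem a) e; rewrite !count_map => ->.
by rewrite -cats1 count_cat /= addn0 addnC.
Qed.

(* Twice the share of e in the number of junctions of sex a: each of its two
   ends counts one half. *)
Definition gap_weight (a : bool) (e : E) : nat :=
  if kind e is Some b then (b == a).*2 else 1.

(** A junction of sex [a] joins one right end and one left end of sex [a], so twice the number of
    junctions is the number of all ends of sex [a], collected block by block. *)
Lemma count_gaps a c L s : arrangement c L s ->
  (count (fun i => rgt i == a) s).*2 = \sum_(e <- c :: L) gap_weight a e.
Proof.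
case=> _ entL ok_s cyc; rewrite -(perm_big _ entL) big_map -addnn.
rewrite {2}(cycle_glue_count _ cyc) -!sum1_count.
rewrite !(big_mkcond (fun i => _ i == a)) -big_split.
apply: eq_big_seq => i /(allP ok_s)/ok_kind; rewrite /gap_weight.
case: (kind (ent i)) => [b [-> ->]|->]; first by case: (b == a).
by case: a (lft i) => [] [].
Qed.

Lemma path_glue_rgt i j s k :
  rgt i = rgt j -> path glue i (rcons s k) = path glue j (rcons s k).
Proof. by move=> e; case: s => [|x s] /=; rewrite /glue e. Qed.

(** Having equal ends, [b] shows its successor the sex that [y] showed before, so the only new
    requirement is at the junction of [y] and [b]. *)
Lemma cycle_glue_insert b p y q :
    lft b = rgt b ->
  cycle glue (p ++ y :: b :: q) = (rgt y == lft b) && cycle glue (p ++ y :: q).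
Proof.
move=> lrb; rewrite -2!(rot_cycle (size p) glue (p ++ _)) !rot_size_cat /=.
rewrite {1}/glue; have [e|//] := eqVneq; by rewrite (@path_glue_rgt b y) ?e.
Qed.

Lemma perm_map_insert b p y q c L :
  perm_eq (map ent (p ++ y :: q)) (c :: L) =
  perm_eq (map ent (p ++ y :: b :: q)) (c :: ent b :: L).
Proof.
rewrite -(perm_cons (ent b)) (permPr (permEl (perm_catCA [:: ent b] [:: c] L))).
have /(perm_map ent)/permPl-> // : perm_eq (p ++ [:: y, b & q]) (b :: p ++ y :: q).
by rewrite -!(cat_rcons y) perm_insert.
Qed.

(** Deleting the block of [e] maps the words over [e :: L] to those over [L]. A fiber consists of
    [v] versions at each junction of sex [a], and by [count_gaps] all words have the same number of
    these. *)
Lemma ncount_arrangement_cons a e v c L N :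
    kind e = Some a -> uniq (e :: c :: L) ->
    ncount (fun i => ok i /\ ent i = e) v ->
    ncount (arrangement c L) N ->
  ncount (arrangement c (e :: L))
    (N * (v * (\sum_(e <- c :: L) gap_weight a e)./2)).
Proof.
move=> ke uecL [V [uV VP sV]] cN.
have /andP[e_cL _] := uecL.
pose f s := [seq i <- s | ent i != e].
have ec : c != e by apply: contraNneq e_cL => ->; rewrite mem_head.
have split_s s : arrangement c (e :: L) s -> exists b p y q,
    [/\ s = p ++ y :: b :: q, f s = p ++ y :: q, ent b = e, ok b
      & rgt y = a /\ arrangement c L (f s)].
  case=> hd prm ok_s cyc.
  have /mapP[b bs eb] : e \in map ent s by rewrite (perm_mem prm) !inE eqxx orbT.
  case/splitPr: bs hd prm ok_s cyc => p q.
  (* The word starts with [c], which differs from [e], so the block [b] has a predecessor [y] in the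
     list. *)
  case/lastP: p => [|p y]; first by move=> /= [ebc]; rewrite eb ebc eqxx in ec.
  rewrite cat_rcons => hd prm ok_s cyc.
  have okb : ok b by move: ok_s; rewrite all_cat /= => /and4P[].
  have := ok_kind okb; rewrite -eb ke => -[lb rb].
  have prm' : perm_eq (map ent (p ++ y :: q)) (c :: L).
    by rewrite (perm_map_insert b) -eb.
  have fs : f (p ++ y :: b :: q) = p ++ y :: q.
    rewrite /f filter_cat /= -eb eqxx /= -[in LHS]/(filter _ (y :: q)) -filter_cat.
    apply/all_filterP; rewrite all_predC -(has_map ent (pred1 e)) has_pred1.
    by rewrite (perm_mem prm').
  move: cyc; rewrite cycle_glue_insert ?lb // => /andP[/eqP ya cyc].
  exists b, p, y, q; split=> //; split=> //; rewrite fs; split=> //.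
  - by case: p hd {prm prm' ok_s fs cyc}.
  - by move: ok_s; rewrite !all_cat /= => /and4P[-> -> _ ->].
apply: (ncount_fiber (f := f) cN) => [s /split_s[b [p [y [q []]]]] _ _ _ _ []//|t at_].
have [hd prm ok_t cyc] := at_.
have [x0 Dx0] : exists x0 : I, True by case: (t) hd => // x0; exists x0.
(* [J] lists the positions after which a block of kind [a] fits. The insertion is at [j.+1], never
   at 0, so [c] stays in front. *)
pose J := [seq j <- iota 0 (size t) | rgt (nth x0 t j) == a].
have sJ : size J = (\sum_(e <- c :: L) gap_weight a e)./2.
  rewrite -(count_gaps a at_) doubleK size_filter.
  by rewrite -[in RHS](mkseq_nth x0 t) count_map.
have ht : ~~ has (fun i => ent i == e) t.
  by rewrite -(has_map ent (pred1 e)) has_pred1 (perm_mem prm).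
rewrite -sV -sJ -(size_allpairs (fun b j => insert_at j.+1 b t)).
apply: ncount_seq.
  apply: allpairs_uniq => //; first by rewrite filter_uniq ?iota_uniq.
  move=> _ _ /allpairsP[[b j] [/= /VP[_ eb] Jj ->]]
    /allpairsP[[b' j'] [/= /VP[_ eb'] Jj' ->]] /= eq_ins.
  move: Jj Jj'; rewrite !mem_filter !mem_iota /= => /andP[_ jt] /andP[_ j't].
  by case: (insert_at_inj ht ht _ _ jt j't eq_ins) => [||[->] -> _]; apply/eqP.
move=> s; split.
  case/allpairsP=> -[b j] /= [/VP[okb eb] + ->].
  rewrite mem_filter mem_iota /= add0n => /andP[/eqP ya jt].
  have := ok_kind okb; rewrite eb ke => -[lb rb].
  have fs : f (insert_at j.+1 b t) = t.
    rewrite /f /insert_at filter_cat /= eb eqxx /= -filter_cat cat_take_drop.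
    by apply/all_filterP; rewrite all_predC.
  split=> //; rewrite /insert_at (take_nth x0) // cat_rcons.
  have Dt2 : t = take j t ++ nth x0 t j :: drop j.+1 t.
    by rewrite -drop_nth // cat_take_drop.
  split.
  - by move: hd; rewrite {1}Dt2; case: (take j t).
  - by rewrite -eb -perm_map_insert -Dt2.
  - by move: ok_t; rewrite {1}Dt2 !all_cat /= okb.
  - by rewrite cycle_glue_insert ?lb ?rb // ya eqxx -Dt2.
case=> /split_s[b [p [y [q [-> -> eb okb [ya _]]]]]] et.
apply/allpairsP; exists (b, size p); split=> /=.
- exact/VP.
- rewrite mem_filter mem_iota -et nth_cat ltnn subnn ya eqxx size_cat /= addnS.
  by rewrite ltnS leq_addr.
- rewrite -et /insert_at -[p ++ y :: q]cat_rcons -(size_rcons p y).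
  by rewrite take_size_cat // drop_size_cat // cat_rcons.
Qed.
(** Each inserted block weighs 2 and so adds one junction of sex [a]: the successive insertions find
    [h], [h + 1], ... places. *)
Lemma ncount_arrangement_cat a (v : E -> nat) h c K L N :
    (forall e, e \in K -> kind e = Some a) -> uniq (K ++ c :: L) ->
    (forall e, e \in K -> ncount (fun i => ok i /\ ent i = e) (v e)) ->
    \sum_(e <- c :: L) gap_weight a e = h.*2 ->
    ncount (arrangement c L) N ->
  ncount (arrangement c (K ++ L))
    (N * \prod_(e <- K) v e * \prod_(j < size K) (h + j)).
Proof.
move=> kK uK vK hL cN; elim: K => [|e K IH] /= in kK uK vK *.
  by rewrite big_nil big_ord0 !muln1.
have perm_cK : perm_eq (K ++ c :: L) (c :: K ++ L) by rewrite perm_insert.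
have{IH}/(ncount_arrangement_cons (kK e (mem_head _ _)) _ (vK e (mem_head _ _))) IH :
  ncount (arrangement c (K ++ L))
    (N * \prod_(e <- K) v e * \prod_(j < size K) (h + j)).
  apply: IH => [x xK||x xK]; [apply: kK | by case/andP: uK | apply: vK];
  by rewrite inE xK orbT.
have sum_cKL : \sum_(e <- c :: K ++ L) gap_weight a e = (h + size K).*2.
  rewrite -(perm_big _ perm_cK) big_cat /= hL (eq_big_seq (fun=> 2)).
    by rewrite big_const_seq count_predT iter_addn_0 mul2n -doubleD addnC.
  by move=> x xK; rewrite /gap_weight kK ?eqxx // inE xK orbT.
rewrite sum_cKL doubleK in IH; rewrite big_cons big_ord_recr /=.
rewrite (mulnC (v e)) [N * _]mulnA mulnACA; apply: IH.
by rewrite -(perm_uniq (s1 := e :: K ++ c :: L)) ?perm_cons.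
Qed.

(** * Words made of couples only *)

Section Couples.

Variable mk : E -> bool -> I.
Hypothesis mkP : forall e a, kind e = None ->
  [/\ ok (mk e a), ent (mk e a) = e & lft (mk e a) = a].
Hypothesis mk_uniq : forall i, ok i -> kind (ent i) = None -> i = mk (ent i) (lft i).

(** [mk e a] is the version of the couple [e] whose left end has sex [a]. Its right end has the
    opposite sex, so gluing forces the orientation to flip from each couple to the next. *)
Fixpoint alternate (a : bool) (l : seq E) : seq I :=
  if l is e :: l' then mk e a :: alternate (~~ a) l' else [::].

Definition only_couples (l : seq E) := all (fun e => kind e == None) l.

Lemma map_ent_alternate a l : only_couples l -> map ent (alternate a l) = l.
Proof. by elim: l a => //= e l IH a /andP[/eqP/(mkP a)[_ -> _] /IH->]. Qed.

Lemma all_ok_alternate a l : only_couples l -> all ok (alternate a l).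
Proof. by elim: l a => //= e l IH a /andP[/eqP/(mkP a)[-> _ _] /IH->]. Qed.

Lemma rgt_mk e a : kind e = None -> rgt (mk e a) = ~~ a.
Proof. by move=> ke; have [/ok_kind + ee ea] := mkP a ke; rewrite ee ke ea. Qed.

(** The number of couples decides the sex of the last right end. When [lft i] is [a], the word
    closes up exactly if [size l] is odd, that is, if the number of couples is even. *)
Lemma path_alternate e a l i : only_couples (e :: l) ->
  path glue (mk e a) (rcons (alternate (~~ a) l) i) = (lft i == a (+) ~~ odd (size l)).
Proof.
elim: l e a => [|e' l IH] e a /= /andP[/eqP ke kl].
  by rewrite /glue rgt_mk // andbT eq_sym addbT.
have /andP[/eqP/(mkP (~~ a))[_ _ lmk] _] := kl.
by rewrite {1}/glue rgt_mk // lmk eqxx /= IH //; case: (a) (odd _) => [] [].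
Qed.

(* The sexes of the junctions alternate along a word made of couples. *)
Lemma alternateP i s : only_couples (map ent (i :: s)) -> all ok (i :: s) ->
  path glue i s -> i :: s = alternate (lft i) (map ent (i :: s)).
Proof.
elim: s i => [|j s IH] i /andP[/eqP ki ks] /andP[oki oks].
  by move=> _ /=; rewrite -mk_uniq.
case/andP=> /eqP ij pjs; have := ok_kind oki; rewrite ki ij => lji.
have -> : alternate (lft i) (map ent (i :: j :: s)) =
    mk (ent i) (lft i) :: alternate (~~ lft i) (map ent (j :: s)) by [].
by rewrite -lji -IH // -mk_uniq.
Qed.

(** The factor 2 is the orientation of [c], the factorial the order of the others. As [size L] is
    odd, the total number of couples is even and every alternating word closes up. *)
Lemma ncount_arrangement_couples c L :
    only_couples (c :: L) -> uniq L -> odd (size L) ->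
  ncount (arrangement c L) (2 * (size L)`!).
Proof.
move=> kcL uL oL; pose P (x : bool * seq E) : Prop := perm_eq x.2 L.
have kp p : perm_eq p L -> only_couples (c :: p).
  by move/perm_all=> pL; move: kcL; rewrite /only_couples /= pL.
apply: (ncount_image (P := P) (f := fun x => alternate x.1 (c :: x.2))).
- rewrite -(size_permutations uL) -(size_allpairs pair [:: true; false]).
  apply: ncount_seq => [|[a p]].
    by apply: allpairs_uniq; rewrite ?permutations_uniq // => -[? ?] [].
  split=> [/allpairsP[[b q] [/= _ + [_ ->]]] | pL]; first by rewrite mem_permutations.
  by apply: allpairs_f; rewrite ?mem_permutations //; case: (a).
- move=> [a p] [b q] /= /kp kcp /kp kcq e.
  have /andP[/eqP kc _] := kcp.
  have := congr1 (map ent) e.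
  rewrite -!/(alternate _ (c :: _)) !map_ent_alternate // => -[->].
  have [_ _ <-] := mkP a kc; have [_ _ <-] := mkP b kc.
  by case: e => ->.
- move=> s; split=> [[hd prm ok_s cyc]|[[a p] pL ->]].
    case: s => // i s in hd prm ok_s cyc *; case: hd => ei.
    exists (lft i, map ent s); first by move: prm; rewrite /= ei perm_cons.
    rewrite -ei; apply: (@alternateP i s) => //.
      by rewrite /only_couples (perm_all _ prm).
    by move: cyc; rewrite /= -cats1 cat_path => /andP[].
  have kcp := kp _ pL; have /andP[/eqP kc _] := kcp.
  split; rewrite ?map_ent_alternate ?all_ok_alternate ?perm_cons //.
  have [_ _ lc] := mkP a kc.
  by rewrite /= path_alternate // (perm_size pL) oL lc addbF.
Qed.

End Couples.
End Arrangements.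

(** * Concatenation of blocks *)

Section Blocks.

(* x0 is a junk default for the ends of an empty block. *)
Variables (T E : eqType) (ent : T -> E) (man : T -> bool) (x0 : T).

Definition flat (s : seq (E * seq T)) : seq T := flatten (map snd s).

Definition homogeneous (i : E * seq T) : bool :=
  (i.2 != [::]) && all (fun x => ent x == i.1) i.2.

Definition first_sex (i : E * seq T) : bool := man (head x0 i.2).
Definition last_sex (i : E * seq T) : bool := man (last x0 i.2).

(** The local form of condition (2), made symmetric, with a shared entity in place of marriage. *)
Definition compatible : rel T := fun x y => (man x == man y) || (ent x == ent y).

Lemma path_compatible_block x b :
  all (fun y => ent y == ent x) b -> path compatible x b.
Proof.
elim: b x => //= y b IH x /andP[/eqP yx bx].
by rewrite /compatible yx eqxx orbT /= IH // yx.
Qed.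

(** Neighbours inside a block share their entity and are compatible. Consecutive blocks have
    different entities, so only the sexes of the facing ends matter. *)
Lemma path_compatible_flat i s :
    all homogeneous (i :: s) -> path (fun i j => i.1 != j.1) i s ->
  path compatible (last x0 i.2) (flat s) = path (glue first_sex last_sex) i s.
Proof.
elim: s i => //= j s IH i /and3P[/andP[i0 hi] /[dup] hj /andP[j0 aj] hs] /andP[ij pjs].
case: j => e [//|y b] /= in hj j0 aj ij pjs *.
have /andP[/eqP ey ab] := aj.
rewrite /flat /= cat_path -/(flat s) path_compatible_block ?ey //=.
rewrite -(IH (e, y :: b)) /= ?hj //; congr (_ && _).
have /eqP el : ent (last x0 i.2) == i.1.
  by apply: (allP hi); case: (i.2) i0 => //= z c _; apply: mem_last.
by rewrite /compatible /glue /last_sex /first_sex /= el ey (negPf ij) orbF.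
Qed.

(** There must be two blocks: a single one meets itself within one entity, where [compatible] holds
    but [glue] may fail. *)
Lemma cycle_compatible_flat s :
    all homogeneous s -> uniq (map fst s) -> 1 < size s ->
  cycle compatible (flat s) = cycle (glue first_sex last_sex) s.
Proof.
case: s => [//|[e b] s] hs us s_gt1.
have neq_path : path (fun i j : E * seq T => i.1 != j.1) (e, b) (rcons s (e, b)).
  rewrite rcons_path; apply/andP; split.
    by move: us; rewrite uniq_pairwise => /pairwise_sorted; rewrite sorted_map.
  case: s us s_gt1 {hs} => //= j s /andP[+ _] _.
  by apply: contraNneq => <-; rewrite -(last_map fst) mem_last.
rewrite [in RHS]/cycle -path_compatible_flat //; last first.
  by move: hs => /= /andP[he hs]; rewrite all_rcons he hs.
case/andP: hs; rewrite /homogeneous /=.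
(* Both sides walk round the same circle, the left one from the first person [x], the right one from
   the end of the first block. *)
case: b {us s_gt1 neq_path} => //= x b /andP[/eqP ex eb] _.
rewrite /flat /= map_rcons flatten_rcons -cat_rcons cat_path -/(flat s).
rewrite !rcons_cat !cat_path /=.
by rewrite last_rcons andbC.
Qed.

Definition contiguous (e : E) (u : seq T) : Prop :=
  exists p1 b p2, [/\ u = p1 ++ b ++ p2, all (fun x => ent x == e) b
    & all (fun x => ent x != e) (p1 ++ p2)].

Lemma contiguous_filter e a u : contiguous e u -> contiguous e (filter a u).
Proof.
move=> [p1 [b [p2 [-> be pe]]]]; exists (filter a p1), (filter a b), (filter a p2).
split; first by rewrite -!filter_cat.
  by apply/allP=> x; rewrite mem_filter => /andP[_ /(allP be)].
by rewrite -filter_cat; apply/allP=> x; rewrite mem_filter => /andP[_ /(allP pe)].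
Qed.

(** The class of the first person is contiguous, hence a prefix. What remains is a filter of [u],
    where the other classes are still contiguous. *)
Lemma contiguous_blocks u : (forall x, x \in u -> contiguous (ent x) u) ->
  exists s, [/\ u = flat s, uniq (map fst s),
    (forall i, i \in s -> i.2 = [seq x <- u | ent x == i.1]) &
    map fst s =i map ent u].
Proof.
have [k] := ubnP (size u); elim: k u => // k IH [|x u] szu cu.
  by exists [::].
have [p1 [b [p2 [Du be pe]]]] := cu _ (mem_head x u).
case: p1 => [|y p1] in Du pe; last first.
  by case: Du pe => <- _ /=; rewrite eqxx.
have bf : b = [seq y <- x :: u | ent y == ent x].
  rewrite Du /= filter_cat (all_filterP be) (@eq_in_filter _ _ pred0 p2).
    by rewrite filter_pred0 cats0.
  by move=> y yp; rewrite (negPf (allP pe _ yp)).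
have p2f : p2 = [seq y <- x :: u | ent y != ent x].
  rewrite Du /= filter_cat (all_filterP pe) (@eq_in_filter _ _ pred0 b).
    by rewrite filter_pred0.
  by move=> y yb; rewrite (allP be _ yb).
have [||s [Ds us sf sm]] := IH p2.
- case: b {bf be p2f} Du => [|z b] /= Du.
    by move: pe; rewrite -Du /= eqxx.
  case: Du szu => _ ->; rewrite ltnS /= size_cat => szu.
  by apply: leq_ltn_trans szu; rewrite leq_addl.
- move=> y yp; rewrite p2f; apply/contiguous_filter/cu.
  by rewrite Du /= mem_cat yp orbT.
have sx i : i \in s -> i.1 != ent x.
  by move/(map_f fst); rewrite sm => /mapP[y yp ->]; exact: (allP pe).
exists ((ent x, b) :: s); split.
- by rewrite /flat /= -/(flat s) -Ds.
- rewrite /= us andbT; apply/mapP=> -[i /sx + exi]; by rewrite -exi eqxx.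
- move=> i; rewrite inE => /predU1P[->//|si].
  rewrite sf // p2f -filter_predI; apply: eq_filter => y /=.
  by case: eqP => //= ->; exact: sx.
- move=> e; rewrite [RHS](_ : _ = (e \in map ent b) || (e \in map ent p2)).
    rewrite /= in_cons sm.
    case: eqP => [->|ne] /=.
      by rewrite bf map_f // mem_filter eqxx mem_head.
    rewrite (negPf (_ : e \notin map ent b)) //; apply/mapP=> -[y yb ey].
    by case: ne; rewrite ey; apply/eqP/(allP be).
  by rewrite Du /= map_cat mem_cat.
Qed.

(** For each predicate the count is a double sum over entities and persons. After exchanging the
    sums, a person counts once because its entity occurs once in [EL]. *)
Lemma perm_flat (U : seq T) (EL : seq E) s :
    uniq EL -> (forall x, x \in U -> ent x \in EL) ->
    perm_eq (map fst s) EL ->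
    (forall i, i \in s -> perm_eq i.2 [seq x <- U | ent x == i.1]) ->
  perm_eq (flat s) U.
Proof.
move=> uEL UEL sEL sU; apply/permP=> P.
rewrite /flat count_flatten -map_comp sumnE big_map.
rewrite (eq_big_seq (fun i => \sum_(x <- U | P x) (ent x == i.1))); last first.
  move=> i /sU/permP/(_ P) /= ->; rewrite count_filter -sum1_count.
  by rewrite big_mkcondr.
rewrite -(big_map fst predT (fun e => \sum_(x <- U | P x) (ent x == e))).
rewrite (perm_big _ sEL).
rewrite exchange_big /= -sum1_count [LHS]big_seq_cond [RHS]big_seq_cond.
apply: eq_bigr => x /andP[/UEL xEL _]; transitivity (count_mem (ent x) EL).
  rewrite -sum1_count [RHS]big_mkcond; apply: eq_bigr => e _ /=.
  by rewrite eq_sym; case: eqP.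
by rewrite count_uniq_mem // xEL.
Qed.

(** The first person reveals the entity of the first block, and [F] then gives its length, so the
    blocks can be read off one by one. *)
Lemma flat_inj (F : E -> nat) s t :
    (forall i, i \in s ++ t -> homogeneous i /\ size i.2 = F i.1) ->
  flat s = flat t -> s = t.
Proof.
elim: s t => [|[e b] s IH] [|[e' b'] t] //= h.
- by have [] := h (e', b') (mem_head _ _); case: b' {h}.
- by have [] := h (e, b) (mem_head _ _); case: b {h}.
have [/andP[b0 /allP eb] sb] := h (e, b) (mem_head _ _).
have [|/andP[b0' /allP eb'] sb'] := h (e', b').
  by rewrite inE mem_cat mem_head !orbT.
move=> /= efl.
have ee : e = e'.
  case: b b0 eb {sb h} efl => // x b _ /(_ x (mem_head _ _))/eqP /= <-.
  by case: b' b0' eb' {sb'} => // x' b' _ /(_ x' (mem_head _ _))/eqP /= <- [->].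
move/eqP: efl; rewrite /flat /= eqseq_cat; last by rewrite sb sb' ee.
case/andP=> /eqP-> /eqP/IH->; first by rewrite ee.
move=> i ist; apply: h; rewrite inE mem_cat inE; move: ist; rewrite mem_cat.
by case/orP=> ->; rewrite !orbT.
Qed.

End Blocks.

(** * Seatings up to rotation *)

Lemma mem_seating (T : finType) (t : #|T|.-tuple T) x : uniq t -> x \in val t.
Proof.
move=> ut; have [||_ ->] := uniq_min_size (s2 := enum T) ut; rewrite ?mem_enum //.
  by move=> y; rewrite mem_enum.
by rewrite -cardE size_tuple.
Qed.

Section Rotations.

Variable T : finType.
Hypothesis T_gt0 : 0 < #|T|.
Implicit Types (s t : #|T|.-tuple T) (A : {set T}).

Lemma same_up_to_rotationP s t :
  reflect (exists d, rot d s = t) (same_up_to_rotation s t).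
Proof.
apply: (iffP existsP) => [[d /eqP <-]|[d st]]; first by exists d.
(* For [d] at least [#|T|], [rot d] is the identity, so the amount 0 replaces [d]. *)
have [dT|Td] := ltnP d #|T|; first by exists (Ordinal dT); apply/eqP.
by exists (Ordinal T_gt0); rewrite rot0 -st rot_oversize ?size_tuple.
Qed.

Lemma same_up_to_rotation_sym s t :
  same_up_to_rotation s t -> same_up_to_rotation t s.
Proof.
case/same_up_to_rotationP=> d st; apply/same_up_to_rotationP.
by exists (size (rot d s) - d); rewrite -st -/(rotr _ _) rotK.
Qed.

Lemma same_up_to_rotation_trans s t u :
  same_up_to_rotation s t -> same_up_to_rotation t u -> same_up_to_rotation s u.
Proof.
case/same_up_to_rotationP=> d st /same_up_to_rotationP[d' tu].
by apply/same_up_to_rotationP; exists (rot_add s d d'); rewrite -rot_rot_add st.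
Qed.

(** [P] is a normal form: every class contains exactly one seating satisfying it. *)
Lemma card_rotation_classes (S : {set #|T|.-tuple T}) (P : pred (seq T)) :
    (forall t d, t \in S -> [tuple of rot d t] \in S) ->
    (forall t, t \in S -> exists d, P (rot d t)) ->
    (forall t d, t \in S -> P t -> P (rot d t) -> rot d t = t) ->
  #|equivalence_partition (@same_up_to_rotation T) S| = #|[set t in S | P t]|.
Proof.
move=> S_rot S_ex S_uniq; pose class t := [set u in S | same_up_to_rotation t u].
have classE s t : same_up_to_rotation s t -> class s = class t.
  move=> st; apply/setP=> u; rewrite !inE; congr (_ && _); apply/idP/idP.
    exact/same_up_to_rotation_trans/same_up_to_rotation_sym.
  exact: same_up_to_rotation_trans.
have refl t : same_up_to_rotation t t.
  by apply/same_up_to_rotationP; exists 0; rewrite rot0.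
rewrite -(@card_in_imset _ _ class); last first.
  move=> s t; rewrite !inE => /andP[sS Ps] /andP[tS Pt] st.
  have : s \in class t by rewrite -st inE sS refl.
  rewrite inE => /andP[_ /same_up_to_rotationP[d ts]].
  by apply: val_inj; rewrite /= -ts S_uniq // ts.
apply: eq_card => B; apply/imsetP/imsetP=> -[t].
  move=> tS ->; have [d Pt] := S_ex t tS.
  exists [tuple of rot d t]; first by rewrite inE S_rot.
  by apply: classE; apply/same_up_to_rotationP; exists d.
by rewrite inE => /andP[tS _] ->; exists t.
Qed.

Lemma sits_togetherP t A :
  reflect (exists d, [set x in take #|A| (rot d t)] = A) (sits_together t A).
Proof.
apply: (iffP existsP) => [[d /eqP tA]|[d tA]]; first by exists d.
have [dT|Td] := ltnP d #|T|; first by exists (Ordinal dT); apply/eqP.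
exists (Ordinal T_gt0); rewrite rot0.
by rewrite -[in X in take _ X](@rot_oversize _ d t) ?size_tuple ?tA.
Qed.

Lemma sits_together_rot d t A :
  sits_together t A -> sits_together [tuple of rot d t] A.
Proof.
case/sits_togetherP=> d' tA; apply/sits_togetherP.
have /same_up_to_rotation_sym : same_up_to_rotation t [tuple of rot d t].
  by apply/same_up_to_rotationP; exists d.
case/same_up_to_rotationP=> d1 e; exists (rot_add (rot d t) d1 d').
by rewrite -rot_rot_add /= e.
Qed.

(** The first person is outside [A], so the arc of [A] does not run across the cut between the last
    and the first seat. *)
Lemma sits_together_linear t A x :
    x \notin A -> ohead t = Some x -> sits_together t A ->
  exists p1 b p2, [/\ val t = p1 ++ b ++ p2, size b = #|A| & [set y in b] = A].
Proof.
move=> xA hd /sits_togetherP[d tA].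
have [dA|] := leqP #|A| (size (drop d t)).
  exists (take d t), (take #|A| (drop d t)), (drop #|A| (drop d t)).
  split; [by rewrite !cat_take_drop | by rewrite size_takel |].
  by rewrite -{2}tA /rot takel_cat.
(* An arc longer than [drop d t] wraps round and contains the first person [x]. *)
move=> Ad; case/negP: xA; rewrite -tA inE /rot take_cat ltnNge ltnW //= mem_cat.
have := max_card (mem A); rewrite -[in X in _ <= X](size_tuple t).
move: hd Ad; case: (val t) => //= y u [->] Ad Au; apply/orP; right.
case: d {tA} Ad => [|d]; first by rewrite drop0 ltnNge Au.
by rewrite -subn_gt0 /=; case: (_ - _) => // k _; rewrite mem_head.
Qed.

(** Suppose [0 < d < #|T|], so that the arc of [A] begins both at seat 0 and at seat [d]. Then seat
    [d] lies in the first arc, whence [d < #|A|]; so seat [#|A|] lies in the second arc but not in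
    the first. *)
Lemma anchor_uniq t d A :
    uniq t -> 0 < #|A| < #|T| -> [set x in take #|A| t] = A ->
  [set x in take #|A| (rot d t)] = A -> rot d t = t.
Proof.
move=> ut /andP[A_gt0 AT] tA dA.
have [Td|dT] := leqP #|T| d; first by rewrite rot_oversize ?size_tuple.
have [->|d_gt0] := posnP d; first by rewrite rot0.
have /card_gt0P[x0 _] := T_gt0.
have inA k : (nth x0 t k \in A) -> k < #|T| -> k < #|A|.
  move=> + kT; rewrite -{1}tA inE in_take ?mem_nth ?size_tuple //.
  by rewrite index_uniq ?size_tuple.
have rotE k : k + d < #|T| -> k < #|A| -> nth x0 t (k + d) \in A.
  move=> kdT kA; rewrite -{1}dA inE addnC -nth_drop.
  have kd : k < size (drop d t) by rewrite size_drop size_tuple ltn_subRL addnC.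
  have -> : nth x0 (drop d t) k = nth x0 (take #|A| (rot d t)) k.
    by rewrite nth_take // /rot nth_cat kd.
  by rewrite mem_nth // size_take size_rot size_tuple AT.
have dA_lt : d < #|A| by apply: inA => //; rewrite -(add0n d) rotE.
have := rotE (#|A| - d); rewrite subnK; last exact: ltnW.
by move=> /(_ AT); rewrite ltn_subrL d_gt0 A_gt0 => /(_ isT)/inA/(_ AT); rewrite ltnn.
Qed.

End Rotations.

Lemma next_prev_rot (T : eqType) (u : seq T) d x v :
  uniq u -> rot d u = x :: v -> v != [::] -> next u x = head x v /\ prev u x = last x v.
Proof.
move=> uu e H; rewrite -(next_rot d uu) -(prev_rot d uu) e.
have uv : uniq (x :: v) by rewrite -e rot_uniq.
split; first by case: v {e uv} H => //= y v _; rewrite eqxx.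
case/lastP: v {e} uv H => // v z uv _; rewrite last_rcons -(prev_rotr 1 uv).
by rewrite -rcons_cons rotr1_rcons /= eqxx.
Qed.

(** * Seatings and blocks of persons *)

Section Persons.

Variables (r : nat) (n : nat -> nat) (m w : nat).

Local Notation P := (person r n m w).
Local Notation family := (Defs.family r n).

Definition entity : finType := (family + 'I_m + 'I_w)%type.

Definition entity_of (p : P) : entity :=
  match p with
  | Husband f | Wife f _ => inl (inl f)
  | SingleMan i => inl (inr i)
  | SingleWoman j => inr j
  end.

Definition wives (f : family) : seq P := [seq Wife f j | j <- enum 'I_(nb_wives f)].

(** A reference order of the members; the blocks of a seating are its permutations. *)
Definition block (e : entity) : seq P :=
  match e with
  | inl (inl f) => Husband f :: wives f
  | inl (inr i) => [:: SingleMan i]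
  | inr j => [:: SingleWoman j]
  end.

Definition kind (e : entity) : option bool :=
  match e with
  | inl (inl f) => if 1 < nb_wives f then Some false else None
  | inl (inr _) => Some true
  | inr _ => Some false
  end.

Lemma Wife_inj f : injective (@Wife r n m w f).
Proof.
move=> i j /(congr1 (@person_encode r n m w)) /= [] /eqP.
by rewrite eq_Tagged => /eqP.
Qed.

Lemma Husband_wives f g : Husband f \notin wives g.
Proof. by apply/mapP=> -[]. Qed.

Lemma wives_uniq f : uniq (wives f).
Proof. by rewrite map_inj_uniq ?enum_uniq //; apply: Wife_inj. Qed.

Lemma block_uniq e : uniq (block e).
Proof. by case: e => [[f|i]|j] //=; rewrite wives_uniq Husband_wives. Qed.

Lemma mem_block e p : (p \in block e) = (entity_of p == e).
Proof.
case: e => [[f|i]|j] /=; rewrite inE; last 2 first.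
- by apply/eqP/eqP=> [->//|]; case: p => //= ? [->].
- by apply/eqP/eqP=> [->//|]; case: p => //= ? [->].
apply/orP/eqP=> [[/eqP->//|/mapP[j _ ->//]]|].
case: p => //= [g|g j] [e]; first by left; rewrite e.
by right; case: _ / e j => j; apply: map_f; rewrite mem_enum.
Qed.

Lemma perm_block e : perm_eq (block e) [seq p <- enum {: P} | entity_of p == e].
Proof.
apply: uniq_perm => [||p]; [exact: block_uniq | exact/filter_uniq/enum_uniq |].
by rewrite mem_block mem_filter mem_enum andbT.
Qed.

Lemma block_neq0 e : block e != [::].
Proof. by case: e => [[f|i]|j]. Qed.

Lemma block_inhabited e : exists p, p \in block e.
Proof.
by case: (block e) (block_neq0 e) => // p b _; exists p; exact: mem_head.
Qed.

Lemma set_block f : [set p in block (inl (inl f))] = members m w f.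
Proof. by apply/setP=> p; rewrite !in_set mem_block; case: p. Qed.

Lemma card_members f : #|members m w f| = size (block (inl (inl f))).
Proof. by rewrite -set_block cardsE; apply/card_uniqP/block_uniq. Qed.

Lemma is_wife_ofE (p : P) f :
  is_wife_of p (Husband f) = (entity_of p == inl (inl f)) && (p != Husband f).
Proof.
case: p => [g|g j|i|j] //=; rewrite ?andbT //.
by apply/esym/andP=> -[/eqP[->]]; rewrite eqxx.
Qed.

(** A man and a woman of the same entity are husband and wife. The cycle tests each person against
    the next one only; when the next one is the man, condition (2) is applied to him and his
    [prev]. *)
Lemma only_own_wives_compatible (t : #|{: P}|.-tuple P) : uniq t ->
  only_own_wives_adjacent t = cycle (compatible entity_of (@is_man r n m w)) t.
Proof.
move=> ut; have inT x := mem_seating x ut.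
have wife x y : is_man x -> ~~ is_man y ->
    is_wife_of y x = (entity_of x == entity_of y).
  by case: x y => [f|f j|i|j] [g|g k|i'|j'] //= _ _; rewrite eq_sym.
apply/idP/idP=> [/forallP own0 | cyc]; last first.
  apply/forallP=> x; apply/forallP=> y.
  apply/implyP=> /and3P[mx wy]; rewrite wife // => /orP[] /eqP exy.
    by have := next_cycle cyc (inT x); rewrite exy /compatible mx (negPf wy).
  by have := prev_cycle cyc (inT x); rewrite exy /compatible mx (negPf wy) => /eqP->.
have own x y := forallP (own0 x) y.
apply: cycle_from_next => // x _; rewrite /compatible.
have [//|xy] := eqVneq; case: (boolP (is_man x)) xy => [mx | wx].
  case: (boolP (is_man _)) => // wy _; rewrite -wife //.
  by apply: (implyP (own _ _)); rewrite mx wy /adjacent eqxx.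
case: (boolP (is_man _)) => // my _; rewrite eq_sym -wife //.
by apply: (implyP (own _ _)); rewrite my wx /adjacent prev_next // eqxx orbT.
Qed.

Definition layout (s : seq (entity * seq P)) : Prop :=
  perm_eq (map fst s) (enum entity) /\
  forall i, i \in s -> perm_eq i.2 (block i.1).

Lemma homogeneous_block (i : entity * seq P) :
  perm_eq i.2 (block i.1) -> homogeneous entity_of i.
Proof.
move=> ib; rewrite /homogeneous -size_eq0 (perm_size ib) size_eq0 block_neq0.
by rewrite (perm_all _ ib); apply/allP=> p; rewrite mem_block.
Qed.

Lemma perm_flat_layout s : layout s -> perm_eq (flat s) (enum {: P}).
Proof.
case=> sE sB; apply: perm_flat sE _; first exact: enum_uniq.
  by move=> p _; rewrite mem_enum.
by move=> i /sB/perm_trans; apply; exact: perm_block.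
Qed.

Lemma flat_cat (s1 s2 : seq (entity * seq P)) : flat (s1 ++ s2) = flat s1 ++ flat s2.
Proof. by rewrite /flat map_cat flatten_cat. Qed.

(** [flat s2 ++ flat s1] is the rest of the circle, read onwards from the end of the block [i]. *)
Lemma layout_split (s : seq (entity * seq P)) i : layout s -> i \in s ->
  exists s1 s2, [/\ s = s1 ++ i :: s2, perm_eq i.2 (block i.1) &
      forall p, p \in flat s2 ++ flat s1 -> entity_of p != i.1].
Proof.
move=> [sE sB] si; have ib := sB i si; case/splitPr: si => s1 s2 in sE sB *.
exists s1, s2; split=> // p; rewrite mem_cat orbC -mem_cat -flat_cat.
case/flattenP=> _ /mapP[j js ->] pj.
have js' : j \in s1 ++ i :: s2.
  by move: js; rewrite !mem_cat inE => /orP[]->; rewrite ?orbT.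
have /eqP -> : entity_of p == j.1 by rewrite -mem_block -(perm_mem (sB j js')).
have : uniq (map fst (i :: s1 ++ s2)).
  rewrite -(perm_uniq (perm_map fst (perm_insert s1 i s2))).
  by rewrite (perm_uniq sE) enum_uniq.
by case/andP=> + _; apply: contraNneq => <-; exact: map_f.
Qed.

Lemma is_man_block f (p : P) : p \in block (inl (inl f)) -> is_man p = (p == Husband f).
Proof.
by rewrite mem_block; case: p => //= g /eqP[->]; rewrite eqxx.
Qed.

Variable x0 : P.

Definition fst_sex : entity * seq P -> bool := first_sex (@is_man r n m w) x0.
Definition lst_sex : entity * seq P -> bool := last_sex (@is_man r n m w) x0.

(** Condition (3) read off the ends of a block: women at both ends put the husband of a larger
    family inside. Couples are unconstrained. *)
Definition settled (i : entity * seq P) : bool :=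
  if kind i.1 is Some a then (fst_sex i == a) && (lst_sex i == a) else true.

Lemma families_together_flat (t : #|{: P}|.-tuple P) s :
  layout s -> val t = flat s -> families_together t.
Proof.
move=> sL ts; apply/forallP=> f; have [sE _] := sL.
have /mapP[i si fi] : inl (inl f) \in map fst s by rewrite (perm_mem sE) mem_enum.
have [s1 [s2 [Ds bf _]]] := layout_split sL si.
apply/sits_togetherP; first by apply/card_gt0P; exists x0.
exists (size (flat s1)); rewrite ts Ds flat_cat rot_size_cat.
rewrite card_members fi -(perm_size bf) -catA take_size_cat // -set_block fi.
by apply/setP=> p; rewrite !in_set (perm_mem bf).
Qed.

(** The husband is the only man of his block, so an end is male exactly when he sits there. His
    neighbour on that side then belongs to another block, which exists as [1 < size s]; otherwise
    the neighbour is a wife. *)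
Lemma husband_neighbours (t : #|{: P}|.-tuple P) s i f :
    uniq t -> layout s -> val t = flat s -> 1 < size s ->
    i \in s -> i.1 = inl (inl f) ->
  is_wife_of (prev t (Husband f)) (Husband f) = ~~ fst_sex i /\
  is_wife_of (next t (Husband f)) (Husband f) = ~~ lst_sex i.
Proof.
move=> ut sL ts s_gt1 si fi; have [s1 [s2 [Ds bf others]]] := layout_split sL si.
set R := flat s2 ++ flat s1 in others.
have R0 : R != [::].
  have : 0 < size (s2 ++ s1) by move: s_gt1; rewrite Ds !size_cat /= addnS addnC.
  have : {subset s2 ++ s1 <= s}.
    by move=> j; rewrite Ds !mem_cat inE => /orP[]->; rewrite ?orbT.
  rewrite /R -flat_cat; case: (s2 ++ s1) => // j s' /(_ j (mem_head _ _)) /(sL.2 j).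
  by move/homogeneous_block=> /andP[]; rewrite /flat /=; case: (j.2).
have : Husband f \in i.2 by rewrite (perm_mem bf) fi mem_head.
rewrite /fst_sex /lst_sex /first_sex /last_sex.
have ui : uniq i.2 by rewrite (perm_uniq bf) block_uniq.
have inB p : p \in i.2 -> is_man p = (p == Husband f).
  by rewrite (perm_mem bf) fi => /is_man_block.
have wifeB p : p \in i.2 -> is_wife_of p (Husband f) = ~~ is_man p.
  by move=> /[dup] /inB ->; rewrite (perm_mem bf) mem_block is_wife_ofE fi => ->.
have wifeR p : p \in R -> is_wife_of p (Husband f) = false.
  by move/others; rewrite is_wife_ofE fi => /negPf->.
have man1 p : p \in i.2 -> p != Husband f -> is_man p = false by move=> /inB-> /negPf.
move=> Hi; have [q1 [q2 Di]] : exists q1 q2, i.2 = q1 ++ Husband f :: q2.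
  by case/splitPr: Hi => q1 q2; exists q1, q2.
have rot_t : rot (size (flat s1 ++ q1)) t = Husband f :: q2 ++ R ++ q1.
  have -> : val t = (flat s1 ++ q1) ++ Husband f :: q2 ++ flat s2.
    by rewrite ts Ds flat_cat (_ : flat (i :: s2) = i.2 ++ flat s2) // Di -!catA.
  by rewrite rot_size_cat /R /= !catA.
have [|-> ->] := next_prev_rot ut rot_t; first by case: (q2) (R) R0 => [|? ?] [].
have [Hq1 Hq2] : Husband f \notin q1 /\ Husband f \notin q2.
  move: ui; rewrite Di cat_uniq /= negb_or.
  by case/and3P=> _ /andP[-> _] /andP[].
have in1 p : p \in q1 -> p \in i.2 by rewrite Di mem_cat => ->.
have in2 p : p \in q2 -> p \in i.2 by rewrite Di mem_cat inE => ->; rewrite !orbT.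
have neq1 p : p \in q1 -> p != Husband f by apply: contraTneq => ->.
have neq2 p : p \in q2 -> p != Husband f by apply: contraTneq => ->.
split; rewrite Di.
  case: q1 in1 neq1 {Di rot_t Hq1} => [|z q1] in1 neq1 /=.
    rewrite cats0 last_cat wifeR //.
    by case: (R) R0 => //= y R' _; exact: mem_last.
  rewrite !last_cat /= wifeB ?in1 ?mem_last //.
  by rewrite !man1 ?in1 ?neq1 ?mem_last ?mem_head.
rewrite last_cat /=; case: q2 in2 neq2 {Di rot_t Hq2} => [|z q2] in2 neq2 /=.
  by case: (R) R0 wifeR => //= y R' _ -> //; exact: mem_head.
by rewrite wifeB ?in2 ?mem_head // !man1 ?in2 ?neq2 ?mem_last ?mem_head.
Qed.

Lemma husbands_surrounded_flat (t : #|{: P}|.-tuple P) s :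
    uniq t -> layout s -> val t = flat s -> 1 < size s ->
  husbands_surrounded t = all settled s.
Proof.
move=> ut sL ts s_gt1; have [sE sB] := sL.
apply/forallP/allP=> [sur i si | set_s f].
  rewrite /settled; case Di : i.1 => [[f|k]|k] /=.
  - case: ltnP => // f_gt1; have := implyP (sur f) f_gt1.
    have [-> ->] := husband_neighbours ut sL ts s_gt1 si Di.
    by case: (fst_sex i) (lst_sex i) => [] [].
  - rewrite /fst_sex /lst_sex /first_sex /last_sex.
    by have := sB i si; rewrite Di => /perm_small_eq -> //.
  - rewrite /fst_sex /lst_sex /first_sex /last_sex.
    by have := sB i si; rewrite Di => /perm_small_eq -> //.
have /mapP[i si fi] : inl (inl f) \in map fst s by rewrite (perm_mem sE) mem_enum.
have [-> ->] := husband_neighbours ut sL ts s_gt1 si (esym fi).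
apply/implyP=> f_gt1; have := set_s i si; rewrite /settled -fi /= f_gt1.
by case: (fst_sex i) (lst_sex i) => [] [].
Qed.

Lemma contiguousI (p1 b p2 : seq P) e : uniq (p1 ++ b ++ p2) ->
  (forall p, (p \in b) = (entity_of p == e)) -> contiguous entity_of e (p1 ++ b ++ p2).
Proof.
move=> u be; exists p1, b, p2; split=> //; first by apply/allP=> p; rewrite be.
apply/allP=> p pp; rewrite -be; move: u.
rewrite uniq_catCA cat_uniq => /and3P[_ /hasPn h _].
exact: h.
Qed.

(** As [f0] fills the first seats, no other family runs across the cut. Sitting together thus
    becomes [contiguous], and [contiguous_blocks] cuts the list. *)
Lemma layout_exists (t : #|{: P}|.-tuple P) f0 :
    uniq t -> families_together t ->
    [set p in take #|members m w f0| t] = members m w f0 ->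
  exists s, [/\ layout s, val t = flat s & ohead (map fst s) = Some (inl (inl f0))].
Proof.
move=> ut tog t0; have inT x := mem_seating x ut.
have T_gt0 : 0 < #|{: P}| by apply/card_gt0P; exists x0.
have [x hd xf0] : exists2 x, ohead t = Some x & x \in members m w f0.
  case: (tval t) (inT x0 : x0 \in tval t) t0 => // x u _ t0; exists x => //.
  by rewrite -t0 card_members inE /= mem_head.
have cont p : p \in val t -> contiguous entity_of (entity_of p) t.
  move=> pt; case Dp : (entity_of p) => [[f|k]|k].
  - have [<-|ff0] := eqVneq f0 f.
      rewrite -(cat_take_drop #|members m w f0| t) -[take _ _](cat0s) -catA.
      apply: contiguousI => [|q]; first by rewrite cat0s cat_take_drop.
      by move/setP/(_ q): t0; rewrite !inE => ->; case: (q).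
    have xf : x \notin members m w f.
      by move: xf0; rewrite !inE => /eqP->; apply: contraNneq ff0 => -[->].
    have [p1 [b [p2 [tE _ bE]]]] := sits_together_linear T_gt0 xf hd (forallP tog f).
    rewrite tE; apply: contiguousI => [|q]; first by rewrite -tE.
    by move/setP/(_ q): bE; rewrite !inE => ->; case: (q).
  - have pk q : (q \in [:: p]) = (entity_of q == inl (inr k)).
      by rewrite -mem_block; case: p Dp pt => //= ? [->].
    case/splitPr: pt ut => p1 p2 ut; exact: (@contiguousI p1 [:: p] p2).
  - have pk q : (q \in [:: p]) = (entity_of q == inr k).
      by rewrite -mem_block; case: p Dp pt => //= ? [->].
    case/splitPr: pt ut => p1 p2 ut; exact: (@contiguousI p1 [:: p] p2).
have [s [ts us sf sm]] := contiguous_blocks cont.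
have tP : perm_eq t (enum {: P}).
  by apply: uniq_perm => [//||q]; [exact: enum_uniq | rewrite inT mem_enum].
have sL : layout s.
  split=> [|i si].
    apply: uniq_perm => [//||e]; first exact: enum_uniq.
    rewrite sm mem_enum; apply/mapP.
    have [q qe] := block_inhabited e.
    by exists q => //; apply/esym/eqP; rewrite -mem_block.
  by rewrite (sf i si) (perm_trans (perm_filter _ tP)) // perm_sym perm_block.
exists s; split=> //; have {}hd : ohead (flat s) = Some x by rewrite -ts.
case: s sL {ts us sf sm} hd => //= -[e b] s [_ /(_ _ (mem_head _ _))/homogeneous_block].
case/andP; rewrite /flat /=; case: b => //= y b _ /andP[/eqP <- _] [->].
by congr Some; move: xf0; rewrite -set_block in_set mem_block => /eqP.
Qed.

(** * Versions of a block *)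

Definition ok (i : entity * seq P) : bool :=
  perm_eq i.2 (block i.1) && settled i.

(** The boolean tells whether the husband is on the left. The values are meant for entities of kind
    [None]; the empty block is a default. *)
Definition couple (e : entity) (a : bool) : entity * seq P :=
  (e, if e is inl (inl f) then
        if a then [:: Husband f; Wife f ord0] else [:: Wife f ord0; Husband f]
      else [::]).

Lemma block_couple (f : family) : nb_wives f <= 1 ->
  block (inl (inl f)) = [:: Husband f; Wife f ord0].
Proof.
case: f => -[[|k] ltk] j // _; rewrite /= /wives enum_ordSl /=.
by rewrite (size0nil (s := enum 'I_0)) // size_enum_ord.
Qed.

Lemma couple_ok e a : kind e = None ->
  [/\ ok (couple e a), (couple e a).1 = e & fst_sex (couple e a) = a].
Proof.
case: e => [[f|i]|j] //= ; case: ltnP => // f1 _; split=> //; last by case: a.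
rewrite /ok /settled /= ltnNge f1 andbT /= -/(block (inl (inl f))) block_couple //.
by case: a => //; apply/permP=> p /=; rewrite addnCA.
Qed.

Lemma couple_uniq i : ok i -> kind i.1 = None -> i = couple i.1 (fst_sex i).
Proof.
case: i => [[[f|//]|//] b] /andP[/= pb _]; case: ltnP => // f1 _.
move: pb; rewrite -/(block (inl (inl f))) block_couple // => pb.
have := perm_size pb; case: b pb => [|x [|y [|]]] //= pb _; congr (_, _).
have : x \in [:: Husband f; Wife f ord0] by rewrite -(perm_mem pb) mem_head.
rewrite !inE => /orP[]/eqP ex; rewrite ex /= in pb *.
  by move: pb; rewrite perm_cons => /perm_small_eq ->.
have : perm_eq [:: Wife f ord0; y] [:: Wife f ord0; Husband f].
  by rewrite (perm_trans pb) //; apply/permP=> p /=; rewrite addnCA.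
by rewrite perm_cons => /perm_small_eq ->.
Qed.

Lemma ok_sexes i : ok i ->
  if kind i.1 is Some a then fst_sex i = a /\ lst_sex i = a
  else lst_sex i = ~~ fst_sex i.
Proof.
move=> oki; case Dk: (kind i.1) => [a|].
  by case/andP: oki => _; rewrite /settled Dk => /andP[/eqP fa /eqP la].
have -> := couple_uniq oki Dk.
by case: (i.1) Dk (fst_sex i) => [[f|i']|j'] // _ [].
Qed.

(* The value for a couple is junk: couples are counted by
   ncount_arrangement_couples, with their orientation. *)
Definition nb_versions (e : entity) : nat :=
  if e is inl (inl f) then tag f * (tag f).+1`! else 1.

Lemma ncount_single e : size (block e) = 1 -> ncount (fun i => ok i /\ i.1 = e) 1.
Proof.
move=> e1; apply: (@ncount_seq _ [:: (e, block e)]) => // -[e' b].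
rewrite inE; split=> [/eqP[-> ->]|[/andP[/= pb _] /= ee]]; last first.
  by rewrite ee in pb *; rewrite (perm_small_eq _ pb) // e1.
rewrite /ok /settled perm_refl /=; split=> //.
by case: e e1 => [[f|i]|j] //= []; rewrite size_map size_enum_ord.
Qed.

(** In a k-tuple [tag f] is k - 2. The k - 1 wives come in any order, and the husband takes one of
    the k - 2 places between two of them. *)
Lemma ncount_family f : 1 < nb_wives f ->
  ncount (fun i => ok i /\ i.1 = inl (inl f)) (tag f * (tag f).+1`!).
Proof.
move=> f_gt1; pose H : P := Husband f; pose W : seq P := wives f.
have sW : size W = (tag f).+1 by rewrite size_map size_enum_ord.
have HW p : perm_eq p W -> H \notin p by move/perm_mem->; exact: Husband_wives.
pose Q (x : nat * seq P) : Prop := 0 < x.1 <= tag f /\ perm_eq x.2 W.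
pose g (x : nat * seq P) := (inl (inl f) : entity, insert_at x.1 H x.2).
apply: (ncount_image (P := Q) (f := g)).
- rewrite -{1}(size_iota 1 (tag f)) -sW -(size_permutations (wives_uniq f)).
  rewrite -(size_allpairs pair); apply: ncount_seq => [|[j p]].
    by apply: allpairs_uniq; rewrite ?iota_uniq ?permutations_uniq // => -[? ?] [].
  split=> [/allpairsP[[j' q] [/= + + [-> ->]]]|[/= jf pW]].
    by rewrite mem_iota mem_permutations.
  by apply: allpairs_f; rewrite ?mem_iota ?mem_permutations.
- move=> [j p] [k q] [/= /andP[_ jf] pW] [/= /andP[_ kf] qW] [].
  case/(@insert_at_inj _ (pred1 H)); rewrite ?has_pred1 ?HW //;
    last by move=> -> _ ->.
  - exact: eqxx.
  - exact: eqxx.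
  - by rewrite (perm_size pW) sW ltnW.
  - by rewrite (perm_size qW) sW ltnW.
have perm_ins p q : perm_eq (p ++ H :: q) (block (inl (inl f))) = perm_eq (p ++ q) W.
  by rewrite (permPl (perm_insert _ _ _)) perm_cons.
move=> [e b]; split=> [[/andP[/= pb set_b] /= ee]|]; last first.
  case=> -[j p] [/= /andP[j_gt0 jf] pW] [-> ->].
  split=> //; rewrite /ok /insert_at /= perm_ins cat_take_drop pW /=.
  have wf x : x \in p -> is_man x = false.
    by rewrite (perm_mem pW) => /mapP[k _ ->].
  have jp : j < size p by rewrite (perm_size pW) sW ltnS.
  rewrite /settled /= f_gt1 /fst_sex /lst_sex /first_sex /last_sex last_cat /=.
  case Dd : (drop j p) => [|y q]; first by move: jp; rewrite -subn_gt0 -size_drop Dd.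
  case Dt : (take j p) => [|x q'].
    by move: j_gt0; rewrite -(size_takel (ltnW jp)) Dt.
  by rewrite /= !wf // -(cat_take_drop j p) mem_cat ?Dd ?Dt ?mem_head ?mem_last ?orbT.
rewrite {e}ee in pb set_b *.
have Hb : H \in b by rewrite (perm_mem pb) mem_head.
case/splitPr: Hb => q1 q2 in pb set_b *; rewrite perm_ins in pb.
have := perm_size pb; rewrite sW size_cat => sq.
exists (size q1, q1 ++ q2).
  split=> //=; move: set_b; rewrite /settled /= f_gt1.
  rewrite /fst_sex /lst_sex /first_sex /last_sex last_cat /=.
  (* With [q1] or [q2] empty the husband would be at an end, which would then be male. *)
  case: q1 {pb} sq => //= x q1; case: q2 => [|y q2]; first by rewrite andbF.
  by rewrite /= addnS => -[<-] _; rewrite addSn ltnS leq_addr.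
by rewrite /g /insert_at /= take_size_cat // drop_size_cat.
Qed.

Lemma ncount_versions e a : kind e = Some a ->
  ncount (fun i => ok i /\ i.1 = e) (nb_versions e).
Proof.
case: e => [[f|i]|j]; last 2 first.
- by move=> _; apply: ncount_single.
- by move=> _; apply: ncount_single.
by rewrite /=; case: ltnP => // f_gt1 _; exact: ncount_family.
Qed.

End Persons.

(** * Reduction of seatings to arrangements *)

Section Counting.

Variables (r : nat) (n : nat -> nat) (m w : nat).

Local Notation P := (person r n m w).
Local Notation family := (Defs.family r n).
Local Notation entity := (entity r n m w).
Local Notation block := (@block r n m w).
Local Notation kind := (@kind r n m w).

Lemma only_own_wives_rot d (t : #|{: P}|.-tuple P) : uniq t ->
  only_own_wives_adjacent [tuple of rot d t] = only_own_wives_adjacent t.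
Proof.
move=> ut; apply: eq_forallb => x; apply: eq_forallb => y.
by rewrite /adjacent /= next_rot // prev_rot.
Qed.

Lemma husbands_surrounded_rot d (t : #|{: P}|.-tuple P) : uniq t ->
  husbands_surrounded [tuple of rot d t] = husbands_surrounded t.
Proof. by move=> ut; apply: eq_forallb => f; rewrite /= next_rot // prev_rot. Qed.

Lemma families_together_rot d (t : #|{: P}|.-tuple P) : 0 < #|{: P}| ->
  families_together t -> families_together [tuple of rot d t].
Proof. by move=> P0 /forallP tog; apply/forallP=> f; exact: sits_together_rot. Qed.

Variable f0 : family.

Definition anchored (u : seq P) : bool :=
  [set p in take #|members m w f0| u] == members m w f0.

(** Being anchored is the normal form for rotations. The person [p1] makes [f0] a proper part of the
    table; a family of all persons would be anchored after every rotation. *)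
Lemma nb_circular_seatings_anchored (p1 : P) : p1 \notin members m w f0 ->
  nb_circular_seatings r n m w = #|[set t in admissible_seatings r n m w | anchored t]|.
Proof.
move=> p1f0; have P0 : 0 < #|{: P}| by apply/card_gt0P; exists p1.
apply: card_rotation_classes => // [t d | t | t d].
- rewrite !inE => /and4P[ut tog own sur].
  apply/and4P; split; first by rewrite /is_seating rot_uniq.
  - exact: families_together_rot.
  - by rewrite only_own_wives_rot.
  - by rewrite husbands_surrounded_rot.
- rewrite inE => /and4P[ut /forallP/(_ f0)/(sits_togetherP P0)[d tA] _ _].
  by exists d; apply/eqP.
rewrite inE => /and4P[ut _ _ _] /eqP t0 /eqP d0.
apply: (anchor_uniq P0 ut _ t0 d0); apply/andP; split; first by rewrite card_members.
rewrite ltn_neqAle max_card andbT; apply: contraNneq p1f0 => f0T.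
rewrite (_ : members m w f0 = setT) ?inE //; apply/eqP.
by rewrite eqEcard subsetT cardsT f0T leqnn.
Qed.

(** A layout satisfies condition (1) by construction; condition (2) becomes the gluing of blocks and
    condition (3) their being settled. [Husband f0] serves as default person. *)
Lemma admissible_flat (t : #|{: P}|.-tuple P) s :
    uniq t -> layout s -> val t = flat s -> 1 < size s ->
  (t \in admissible_seatings r n m w) =
  cycle (glue (fst_sex (Husband f0)) (lst_sex (Husband f0))) s &&
  all (settled (Husband f0)) s.
Proof.
move=> ut sL ts s_gt1; have [sE sB] := sL.
rewrite inE (families_together_flat (Husband f0) sL ts).
rewrite (only_own_wives_compatible ut).
rewrite (husbands_surrounded_flat (Husband f0) ut sL ts s_gt1).
rewrite /is_seating ut /= -(cycle_compatible_flat (ent := @entity_of r n m w)) //.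
- by rewrite -ts.
- by apply/allP=> i /sB/homogeneous_block.
- by rewrite (perm_uniq sE) enum_uniq.
Qed.

Local Notation arr :=
  (arrangement fst (fst_sex (Husband f0)) (lst_sex (Husband f0)) (ok (Husband f0))).

Lemma arrangement_layout (L : seq entity) s :
    perm_eq (inl (inl f0) :: L) (enum entity) -> arr (inl (inl f0)) L s -> layout s.
Proof.
move=> LE [_ sL /allP ok_s _]; split; first exact: perm_trans LE.
by move=> i /ok_s/andP[].
Qed.

Lemma size_arrangement (L : seq entity) (s : seq (entity * seq P)) :
  perm_eq (map fst s) (inl (inl f0) :: L) -> L != [::] -> 1 < size s.
Proof. by move/perm_size; rewrite size_map => ->; case: L. Qed.

Lemma arrangement_seating (L : seq entity) u :
    perm_eq (inl (inl f0) :: L) (enum entity) -> L != [::] ->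
  (exists2 t, t \in [set t in admissible_seatings r n m w | anchored t] & u = val t) <->
  (exists2 s, arr (inl (inl f0)) L s & u = flat s).
Proof.
move=> LE L0; split=> [[t + ->]|[s sA ->]].
  rewrite in_set => /andP[tA /eqP t0].
  have := tA; rewrite inE => /and4P[ut tog _ _].
  have [s [sL ts hd]] := layout_exists (Husband f0) ut tog t0.
  have sE : perm_eq (map fst s) (inl (inl f0) :: L).
    by rewrite (perm_trans sL.1) // perm_sym.
  exists s => //; move: tA; rewrite (admissible_flat ut sL ts (size_arrangement sE L0)).
  case/andP=> cyc /allP set_s; split=> //.
  by apply/allP=> i si; rewrite /ok (sL.2 i si) set_s.
have sL := arrangement_layout LE sA; have [hd sE ok_s cyc] := sA.
have sP := perm_flat_layout sL.
have st : size (flat s) == #|{: P}| by rewrite (perm_size sP) -cardE.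
exists (Tuple st) => //.
rewrite in_set (admissible_flat _ sL) ?(size_arrangement sE) //; last first.
  by rewrite /= (perm_uniq sP) enum_uniq.
rewrite cyc /=; apply/andP; split.
  by apply: sub_all ok_s => i /andP[].
rewrite /anchored /=; case: s hd sL {sA sE ok_s cyc sP st} => //= i s [i0] sL.
rewrite /flat /= card_members -i0 -(perm_size (sL.2 i (mem_head _ _))) take_size_cat //.
rewrite -set_block -i0; apply/eqP/setP=> p.
by rewrite !in_set (perm_mem (sL.2 i (mem_head _ _))).
Qed.

(** Anchored seatings and arrangements are both sent injectively to lists of persons, by [val] and
    by [flat], with the same image. *)
Lemma nb_circular_seatings_arrangement (L : seq entity) N :
    perm_eq (inl (inl f0) :: L) (enum entity) -> L != [::] ->
    ncount (arr (inl (inl f0)) L) N ->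
  nb_circular_seatings r n m w = N.
Proof.
move=> LE L0 cN; have [p1 p1f0] : exists p1, p1 \notin members m w f0.
  have [e eL] : exists e, e \in L.
    by case: L L0 {LE cN} => // e L _; exists e; exact: mem_head.
  have [p pe] := block_inhabited e.
  exists p; rewrite -set_block in_set mem_block; move: pe; rewrite mem_block => /eqP->.
  apply: contraL eL => /eqP->.
  by have := enum_uniq entity; rewrite -(perm_uniq LE) => /andP[].
rewrite (nb_circular_seatings_anchored p1f0).
set S := [set t in _ | _].
have cS : ncount (fun t => t \in S) #|S|.
  by rewrite cardE; apply: ncount_seq; [exact: enum_uniq | move=> t; rewrite mem_enum].
have := ncount_image (f := val) (Q := fun u => exists2 t, t \in S & u = val t) cS.
move/(_ (fun _ _ _ _ => @val_inj _ _ _ _ _)) => /(_ (fun _ => iff_refl _)) cU.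
apply: ncount_inj cU _; apply: (ncount_image (f := @flat _ _) cN).
- move=> s s' sA s'A; pose F (e : entity) := size (block e).
  apply: (flat_inj (ent := @entity_of r n m w) (F := F)) => i ss'.
  have [_ sB] := arrangement_layout LE sA; have [_ sB'] := arrangement_layout LE s'A.
  have pi : perm_eq i.2 (block i.1) by move: ss'; rewrite mem_cat => /orP[/sB|/sB'].
  by split; [exact: homogeneous_block | exact: perm_size].
- by move=> u; exact: arrangement_seating.
Qed.

End Counting.

Lemma rising_factorial h k : 0 < h -> (h.-1)`! * \prod_(j < k) (h + j) = (h + k).-1`!.
Proof.
case: h => // h _; elim: k => [|k IH]; first by rewrite big_ord0 muln1 addn0.
by rewrite big_ord_recr mulnA IH addnS addSn /= factS mulnC.
Qed.

(** * The closed formula *)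

Section Formula.

Variables (r : nat) (n : nat -> nat) (m w : nat).

Local Notation P := (person r n m w).
Local Notation family := (Defs.family r n).
Local Notation entity := (entity r n m w).
Local Notation kind := (@kind r n m w).

Definition of_kind (k : option bool) : seq entity :=
  [seq e <- enum entity | kind e == k].

Lemma mem_of_kind k e : (e \in of_kind k) = (kind e == k).
Proof. by rewrite mem_filter mem_enum andbT. Qed.

Lemma of_kind_uniq k : uniq (of_kind k).
Proof. exact/filter_uniq/enum_uniq. Qed.

Lemma perm_of_kind :
  perm_eq (of_kind (Some true) ++ of_kind (Some false) ++ of_kind None) (enum entity).
Proof.
apply: uniq_perm => [||e]; last 1 first.
- by rewrite !mem_cat !mem_of_kind mem_enum; case: (kind e) => [[]|].
- rewrite !cat_uniq !of_kind_uniq /= andbT; apply/andP; split.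
    by apply/hasPn=> e; rewrite mem_cat !mem_of_kind => /orP[]/eqP->.
  by apply/hasPn=> e; rewrite !mem_of_kind => /eqP->.
- exact: enum_uniq.
Qed.

Lemma big_of_kind (R : Type) (idx : R) (op : Monoid.com_law idx) k (F : entity -> R) :
  \big[op/idx]_(e <- of_kind k) F e = \big[op/idx]_(e | kind e == k) F e.
Proof. by rewrite big_filter big_enum_cond. Qed.

Lemma big_family (R : Type) (idx : R) (op : Monoid.com_law idx)
    (Q : pred nat) (F : nat -> R) :
  \big[op/idx]_(f : family | Q (tag f)) F (tag f) =
  \big[op/idx]_(0 <= i < r.-1 | Q i) \big[op/idx]_(j < n i.+2) F i.
Proof.
rewrite big_mkord.
rewrite (sig_big_dep (fun i : 'I_r.-1 => Q i) (fun _ _ => true) (fun i _ => F i)).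
by apply: eq_bigl => f; rewrite andbT.
Qed.

Hypothesis hr : 2 <= r.

Lemma size_couples : size (of_kind None) = n 2.
Proof.
rewrite -sum1_size big_of_kind /= !big_sumType /=.
rewrite [X in _ + X + _]big_pred0 // [X in _ + X]big_pred0 // !addn0.
(* [Q] is the kind test of a family as a function of its tag [i], the number of wives being [i.+1];
   it holds for tag 0 only. *)
pose Q i := (if 1 < i.+1 then Some false else None) == None.
rewrite (big_family _ Q (fun _ => 1)).
case: r hr => [|[|r']] //= _; rewrite big_mkcond big_nat_recl //= big1_eq addn0.
by rewrite sum1_card card_ord.
Qed.

Lemma size_men : size (of_kind (Some true)) = m.
Proof.
rewrite -sum1_size big_of_kind /= !big_sumType /=.
rewrite big_pred0; last by move=> f; case: ifP.
by rewrite [X in _ + X]big_pred0 // addn0 sum1_card card_ord.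
Qed.

Lemma size_women : size (of_kind (Some false)) = \sum_(3 <= k < r.+1) n k + w.
Proof.
rewrite -sum1_size big_of_kind /= !big_sumType /= [X in _ + X + _]big_pred0 // addn0.
pose Q i := (if 1 < i.+1 then Some false else None) == Some false.
rewrite (big_family _ Q (fun _ => 1)).
rewrite [X in _ + X]sum1_card card_ord; congr (_ + _).
(* Tag 0, that of the couples, drops out; the remaining tags [i.+1] belong to the sizes
   [k = i + 3]. *)
case: r hr => [|[|r']] //= _; rewrite big_mkcond big_nat_recl //= add0n.
rewrite (big_addn 0 _ 3) -addn3 addnK.
by apply: eq_bigr => i _; rewrite sum1_card card_ord addn3.
Qed.

Lemma prod_women : \prod_(e <- of_kind (Some false)) nb_versions e =
  \prod_(3 <= k < r.+1) ((k - 2) * (k - 1)`!) ^ n k.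
Proof.
rewrite big_of_kind /= !big_sumType /= [X in _ * X * _]big_pred0 // muln1.
pose Q i := (if 1 < i.+1 then Some false else None) == Some false.
rewrite (big_family _ Q (fun i => i * i.+1`!)).
rewrite [X in _ * X]big1_eq muln1.
case: r hr => [|[|r']] //= _; rewrite big_mkcond big_nat_recl //= mul1n.
rewrite (big_addn 0 _ 3) -addn3 addnK.
apply: eq_bigr => i _; rewrite prod_nat_const card_ord addn3.
by rewrite subn1 !subSS subn0.
Qed.

(** The blocks with female ends are inserted into the words of couples first, the single men
    afterwards. *)
Lemma nb_seatings h : 0 < h -> n 2 = h.*2 ->
  nb_circular_seatings r n m w =
   2 * (n 2).-1`! * \prod_(e <- of_kind (Some false)) nb_versions e
     * \prod_(j < size (of_kind (Some false))) (h + j) * \prod_(j < m) (h + j).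
Proof.
move=> h_gt0 n2.
have : 0 < size (of_kind None) by rewrite size_couples n2 double_gt0.
rewrite -has_predT => /hasP[e0 e0N _].
have [f0 e0f] : exists f0, e0 = inl (inl f0).
  by move: e0N; rewrite mem_of_kind; case: (e0) => [[f|]|] // _; exists f.
pose x0 : P := Husband f0; rewrite {e0}e0f in e0N.
set c := inl (inl f0) in e0N; pose L0 := rem c (of_kind None).
have permN : perm_eq (of_kind None) (c :: L0) := perm_to_rem e0N.
have sL0 : size L0 = (n 2).-1 by rewrite size_rem // size_couples.
have couples : only_couples kind (c :: L0).
  by rewrite /only_couples -(perm_all _ permN); apply/allP=> e; rewrite mem_of_kind.
have uN : uniq (c :: L0) by rewrite -(perm_uniq permN) of_kind_uniq.
have permE :
    perm_eq (of_kind (Some true) ++ of_kind (Some false) ++ c :: L0) (enum entity).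
  by rewrite -(permPr perm_of_kind) !perm_cat2l perm_sym.
have u_all : uniq (of_kind (Some true) ++ of_kind (Some false) ++ c :: L0).
  by rewrite (perm_uniq permE) enum_uniq.
have sum_couples a : \sum_(e <- c :: L0) gap_weight kind a e = h.*2.
  rewrite (eq_big_seq (fun=> 1)) => [|e /(allP couples)/eqP ke]; last first.
    by rewrite /gap_weight ke.
  by rewrite sum1_size /= sL0 prednK // n2 double_gt0.
have okK := @ok_sexes r n m w x0.
have cN : ncount (arrangement fst (fst_sex x0) (lst_sex x0) (ok x0) c L0)
    (2 * (n 2).-1`!).
  rewrite -sL0; apply: (ncount_arrangement_couples okK (mk := @couple r n m w)) => //.
  - exact: couple_ok.
  - exact: couple_uniq.
  - by case/andP: uN.
  - by rewrite sL0 n2 -subn1 oddB ?double_gt0 // odd_double.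
have versions a e : e \in of_kind (Some a) ->
    ncount (fun i => ok x0 i /\ i.1 = e) (nb_versions e).
  by rewrite mem_of_kind => /eqP; exact: ncount_versions.
have kindE k e : e \in of_kind k -> kind e = k by rewrite mem_of_kind => /eqP.
have u_women : uniq (of_kind (Some false) ++ c :: L0).
  by move: u_all; rewrite cat_uniq => /and3P[].
have {}cN :=
  ncount_arrangement_cat okK (kindE _) u_women (@versions _) (sum_couples false) cN.
have perm_wc :
    perm_eq (of_kind (Some false) ++ c :: L0) (c :: of_kind (Some false) ++ L0).
  exact: perm_insert.
(* Blocks with female ends have weight 0 for male junctions, so the men also start from [h]
   junctions. *)
have sum_men :
    \sum_(e <- c :: of_kind (Some false) ++ L0) gap_weight kind true e = h.*2.
  rewrite -(perm_big _ perm_wc) big_cat /= sum_couples big_seq big1 // => e.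
  by move/kindE; rewrite /gap_weight => ->.
have u_men : uniq (of_kind (Some true) ++ c :: of_kind (Some false) ++ L0).
  by rewrite -(perm_uniq (perm_cat (perm_refl (of_kind (Some true))) perm_wc)).
have {}cN := ncount_arrangement_cat okK (kindE _) u_men (@versions _) sum_men cN.
rewrite (nb_circular_seatings_arrangement _ _ cN).
(* A single man has one version, so the product of the versions is 1. *)
- rewrite size_men [X in _ * X * _]big_seq [X in _ * X * _]big1 ?muln1 // => e /kindE.
  by case: e => [[f|i]|j] //=; case: ifP.
- apply: (perm_trans _ permE); rewrite perm_sym !catA; exact: perm_insert.
- rewrite -size_eq0 !size_cat sL0 n2.
  by case: (h) h_gt0 => // h' _; rewrite doubleS !addnS.
Qed.

End Formula.

(* Both divisions are exact: in each case the divisor is the factorial of a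
   number that is at most the one in the dividend. *)
Theorem corollary1p2 (r : nat) (n : nat -> nat) (m w : nat)
    (hr : 2 <= r) (hn2_even : ~~ odd (n 2)) (hn2 : 2 <= n 2) :
  nb_circular_seatings r n m w =
    (\prod_(3 <= k < r.+1) ((k - 2) * (k - 1)`!) ^ n k)
    * ((n 2)`! %/ ((n 2) %/ 2)`!)
    * (((n 2) %/ 2 + m - 1)`! %/ ((n 2) %/ 2 - 1)`!)
    * (\sum_(3 <= k < r.+1) n k + (n 2) %/ 2 + w - 1)`!.
Proof.
have n2 : n 2 = ((n 2)./2).*2 by rewrite even_halfK.
have h_gt0 : 0 < (n 2)./2 by rewrite half_gt0.
rewrite (nb_seatings m w hr h_gt0 n2) prod_women // size_women // divn2 !subn1.
set h := (n 2)./2 in n2 h_gt0 *; rewrite n2.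
set pv := \prod_(3 <= k < _) _; set S := \sum_(3 <= k < _) _.
have -> : S + h + w = h + (S + w) by rewrite addnAC addnC.
(* Both factorials split off (h - 1)!. It cancels in the quotient, and the copy left in the last
   factor is absorbed by the next identity. *)
rewrite -!rising_factorial // mulKn ?fact_gt0 //.
have -> : 2 * (h.*2).-1`! = h.*2`! %/ h`! * h.-1`!.
  have fact_pred k : 0 < k -> k`! = k * k.-1`! by case: k.
  (* Multiplied by [h], both sides become (2h)!. *)
  apply/eqP; rewrite -(eqn_pmul2l h_gt0) mulnA (mulnC h) mul2n.
  rewrite -fact_pred ?double_gt0 //.
  rewrite mulnCA -fact_pred // divnK // -[X in _ %| X](@ffact_fact _ h) -addnn.
    by rewrite addnK dvdn_mull.
  exact: leq_addr.
by rewrite [RHS]mulnAC (mulnC (_ * _) pv) !mulnA.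
Qed.
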